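(* Let $\mathcal{A}$ and $\mathcal{B}$ be two unital complex $\ast$-algebras with multiplicative identities $1_{\mathcal{A}}$ and $1_{\mathcal{B}}$, respectively, such that $\mathcal{A}$ is prime and has a nontrivial projection. Let $\eta,\nu$ be nonzero complex numbers and let $\Phi:\mathcal{A}\rightarrow\mathcal{B}$ be a bijective mapping (not assumed additive or linear) such that $\Phi(1_{\mathcal{A}})$ is a projection. (A) Suppose $\Phi$ preserves the triple product $a\blacksquare_{\eta}b\blacksquare_{\nu}c$, i.e. $\Phi((a\blacksquare_{\eta}b)\blacksquare_{\nu}c)=(\Phi(a)\blacksquare_{\eta}\Phi(b))\blacksquare_{\nu}\Phi(c)$ for all $a,b,c\in\mathcal{A}$, and that at least one of the following holds: (i) $\overline{\eta}\neq -1$, $\nu\neq\pm 1$, and $\Phi((\overline{\eta}+1)(1-\nu)a)=(\overline{\eta}+1)(1-\nu)\Phi(a)$ for all $a\in\mathcal{A}$; or (ii) $\overline{\eta}\neq\pm 1$, $\nu\neq -1$, and $\Phi((\overline{\eta}-1)(1+\nu)a)=(\overline{\eta}-1)(1+\nu)\Phi(a)$ for all $a\in\mathcal{A}$. Then $\Phi$ is a $\ast$-ring isomorphism. In particular, if $\Phi$ preserves this triple product and either ($\overline{\eta}\neq -1$, $\nu\neq\pm 1$ and $(\overline{\eta}+1)(1-\nu)$ is a rational number) or ($\overline{\eta}\neq\pm 1$, $\nu\neq -1$ and $(\overline{\eta}-1)(1+\nu)$ is a rational number), then $\Phi$ is a $\ast$-ring isomorphism. (B) Suppose $\Phi$ preserves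 the mixed product $a\blacksquare_{\eta}b\circ_{\nu}c$, i.e. $\Phi((a\blacksquare_{\eta}b)\circ_{\nu}c)=(\Phi(a)\blacksquare_{\eta}\Phi(b))\circ_{\nu}\Phi(c)$ for all $a,b,c\in\mathcal{A}$, and that at least one of the following holds: (i) $\eta\neq -1$, $|\nu|\neq 1$, and $\Phi((\eta+1)(1-\nu)a)=(\eta+1)(1-\nu)\Phi(a)$ for all $a\in\mathcal{A}$; or (ii) $|\eta|\neq 1$, $\nu\neq -1$, and $\Phi((\eta-1)(1+\nu)a)=(\eta-1)(1+\nu)\Phi(a)$ for all $a\in\mathcal{A}$. Then $\Phi$ is a $\ast$-ring isomorphism. In particular, if $\Phi$ preserves this mixed product and either ($\eta\neq -1$, $|\nu|\neq 1$ and $(\eta+1)(1-\nu)$ is a rational number) or ($|\eta|\neq 1$, $\nu\neq -1$ and $(\eta-1)(1+\nu)$ is a rational number), then $\Phi$ is a $\ast$-ring isomorphism.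
   Context: A complex $\ast$-algebra is an associative complex algebra with a conjugate-linear involution $\ast$ satisfying $(ab)^*=b^*a^*$. For elements $a,b$ of a complex $\ast$-algebra and a nonzero complex number $\eta$ (resp. $\nu$), $a\blacksquare_{\eta}b=a^{*}b+\eta ba^{*}$ and $a\circ_{\nu}b=ab+\nu ba$. A projection is an element $p$ with $p=p^*=p^2$; it is nontrivial if $p\neq 0$ and $p\neq 1$. An algebra is prime if $a\mathcal{A}b=\{0\}$ implies $a=0$ or $b=0$. A $\ast$-ring isomorphism is an additive bijection $\Phi$ with $\Phi(a^* )=\Phi(a)^*$ and $\Phi(ac)=\Phi(a)\Phi(c)$ for all $a,c$; complex linearity is not required. *)

(* Defs.v *)
From HB Require Import structures.
From mathcomp Require Import all_boot all_order all_algebra.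

Set Implicit Arguments.
Unset Strict Implicit.
Unset Printing Implicit Defensive.

Import Order.TTheory GRing.Theory Num.Theory.
Local Open Scope ring_scope.

(* Rings in the [algType] hierarchy satisfy 1 != 0. This excludes only the
   zero algebra, which has no nontrivial projection and is not in bijection
   with an algebra that has one. *)
HB.mixin Record isStarAlgebra (C : numClosedFieldType) A
    of GRing.Algebra C A := {
  star : A -> A;
  starK : involutive star;
  starD : {morph star : x y / x + y};
  starZ : forall (k : C) (x : A), star (k *: x) = k^* *: star x;
  starM : forall x y : A, star (x * y) = star y * star x
}.

#[short(type="starAlgType")]
HB.structure Definition StarAlgebra (C : numClosedFieldType) :=
  {A of isStarAlgebra C A & GRing.Algebra C A}.

Section StarAlgebraTheory.
Variables (C : numClosedFieldType) (A : starAlgType C).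
Implicit Types (a b p : A) (k : C).

(* The product written a ■_k b. *)
Definition sqprod k a b : A := star a * b + k *: (b * star a).

(* The product written a ∘_k b. *)
Definition circprod k a b : A := a * b + k *: (b * a).

Definition projection p : Prop := p = star p /\ p = p * p.

Definition nontrivial_projection p : Prop :=
  [/\ projection p, p <> 0 & p <> 1].

Definition prime_algebra : Prop :=
  forall a b, (forall x : A, a * x * b = 0) -> a = 0 \/ b = 0.

End StarAlgebraTheory.

Definition preserves_sq_sq (C : numClosedFieldType) (A B : starAlgType C)
    (eta nu : C) (Phi : A -> B) : Prop :=
  forall a b c : A,
    Phi (sqprod nu (sqprod eta a b) c) =
    sqprod nu (sqprod eta (Phi a) (Phi b)) (Phi c).

Definition preserves_sq_circ (C : numClosedFieldType) (A B : starAlgType C)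
    (eta nu : C) (Phi : A -> B) : Prop :=
  forall a b c : A,
    Phi (circprod nu (sqprod eta a b) c) =
    circprod nu (sqprod eta (Phi a) (Phi b)) (Phi c).

Definition commutes_with_scalar (C : numClosedFieldType) (A B : starAlgType C)
    (k : C) (Phi : A -> B) : Prop :=
  forall a : A, Phi (k *: a) = k *: Phi a.

Definition star_ring_isomorphism (C : numClosedFieldType)
    (A B : starAlgType C) (Phi : A -> B) : Prop :=
  [/\ bijective Phi,
      {morph Phi : a b / a + b},
      {morph Phi : a / star a} &
      {morph Phi : a c / a * c}].

Definition rational_number (C : numClosedFieldType) (z : C) : Prop :=
  exists q : rat, z = ratr q.

(* Main.v *)
Require Import Defs.
From HB Require Import structures.
From mathcomp Require Import all_boot all_order all_algebra.
From mathcomp Require Import complex.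
From mathcomp Require Import reals.

Set Implicit Arguments.
Unset Strict Implicit.
Unset Printing Implicit Defensive.

Import Order.TTheory GRing.Theory Num.Theory.
Local Open Scope ring_scope.

(** The triple product of (A) is the mixed product of (B) in disguise: since
    the adjoint of a ■_η b is b ■_ζ a, where ζ is the conjugate of η, preserving
    ■_η, ■_ν amounts to preserving ■_ζ, ∘_ν.  So everything is proved for the product
    T(x, y, c) = (x ■_ζ y) ∘_ν c, with ζ and ν different from -1 and with one
    of them, called κ below, also different from 0 and 1.

    Additivity.  Putting units into T shows that each operator
    c |-> d c + κ c d is carried by Phi to an additive operator of B
    ([transported_nu], [transported_zeta]).  By surjectivity there is t with
    Phi t = Phi a + Phi b; if Phi is already additive on the images of a and b
    under such an operator, injectivity forces that operator to kill the defect
    t - (a + b) ([additive_pair_by_defect]).  For d = α_1 p + α_2 (1 - p) the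
    operator acts on the Peirce corner (i, j) as multiplication by
    α_i + κ α_j ([circ_diag_corner]), so suitable α kill chosen corners of
    a and b and detect chosen corners of the defect; as κ^2 <> 1, the two
    off-diagonal corners can be told apart.  Hence Phi is additive across
    corners ([phi_peirce]).  Inside an off-diagonal corner additivity follows
    from a + b = (P_i + a) ∘_ν (P_j + b), and inside a diagonal corner from the
    off-diagonal case together with primeness.

    Multiplicativity.  Evaluating T at units gives Phi 1 = 1, then that Phi
    commutes with (1 + ζ)(1 + ν) and with the involution.  The symmetric part
    in y, c of Phi (T(1, y, c)) shows that Phi preserves y c + c y; its
    antisymmetric part carries the factor (ζ + 1)(1 - ν), and once Phi commutes
    with that scalar it preserves y c - c y too.  The scalar (ζ - 1)(1 + ν)
    comes likewise from T(x^*, y, 1).  An additive map commutes with rational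
    scalars, which gives the two rational variants. *)

(** * The products *)

Section Products.
Variables (C : numClosedFieldType) (A : starAlgType C).
Implicit Types (a b c x y : A) (k : C).

Lemma star1 : star (1 : A) = 1.
Proof. by rewrite -[LHS]mulr1 -{2}(starK (1 : A)) -starM mulr1 starK. Qed.

Lemma circprodDl k a b c :
  circprod k (a + b) c = circprod k a c + circprod k b c.
Proof. by rewrite /circprod mulrDl mulrDr scalerDr addrACA. Qed.

Lemma circprodDr k a b c :
  circprod k a (b + c) = circprod k a b + circprod k a c.
Proof. by rewrite /circprod mulrDl mulrDr scalerDr addrACA. Qed.

Lemma circprod0r k a : circprod k a 0 = 0.
Proof. by rewrite /circprod mulr0 mul0r scaler0 addr0. Qed.

Lemma circprodNr k a b : circprod k a (- b) = - circprod k a b.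
Proof. by rewrite /circprod mulrN mulNr scalerN opprD. Qed.

Lemma circprodZr k a l b : circprod k a (l *: b) = l *: circprod k a b.
Proof.
by rewrite /circprod -scalerAr -scalerAl scalerDr !scalerA (mulrC k).
Qed.

Lemma circprodZl k l a b : circprod k (l *: a) b = l *: circprod k a b.
Proof.
by rewrite /circprod -scalerAr -scalerAl scalerDr !scalerA (mulrC k).
Qed.

Lemma circprod1l k a : circprod k 1 a = (1 + k) *: a.
Proof. by rewrite /circprod mulr1 mul1r scalerDl scale1r. Qed.

Lemma circprodr1 k a : circprod k a 1 = (1 + k) *: a.
Proof. by rewrite /circprod mulr1 mul1r scalerDl scale1r. Qed.

Lemma sqprodDr k a b c : sqprod k a (b + c) = sqprod k a b + sqprod k a c.
Proof. exact: circprodDr. Qed.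

Lemma sqprod1l k y : sqprod k 1 y = (1 + k) *: y.
Proof. by rewrite /sqprod star1 mul1r mulr1 scalerDl scale1r. Qed.

Lemma sqprodr1 k x : sqprod k x 1 = (1 + k) *: star x.
Proof. by rewrite /sqprod mul1r mulr1 scalerDl scale1r. Qed.

Lemma sqprod_starl k x y : sqprod k (star x) y = circprod k x y.
Proof. by rewrite /sqprod starK. Qed.

Lemma star_sqprod k a b : star (sqprod k a b) = sqprod k^* b a.
Proof. by rewrite /sqprod starD starZ !starM starK. Qed.

Lemma sq_sq_eq_sq_circ k l a b c :
  sqprod l (sqprod k a b) c = circprod l (sqprod k^* b a) c.
Proof. by rewrite -star_sqprod. Qed.

Lemma circprod_add_swap k x y :
  circprod k x y + circprod k y x = (1 + k) *: (x * y + y * x).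
Proof.
rewrite /circprod addrACA -scalerDr scalerDl scale1r; congr (_ + _ *: _).
by rewrite addrC.
Qed.

Lemma circprod_sub_swap k x y :
  circprod k x y - circprod k y x = (1 - k) *: (x * y - y * x).
Proof.
rewrite /circprod opprD addrACA -scalerBr scalerBl scale1r.
by rewrite -[y * x - x * y]opprB scalerN.
Qed.

End Products.

Lemma preserves_sq_sq_circ (C : numClosedFieldType) (A B : starAlgType C)
    (eta nu : C) (Phi : A -> B) :
  preserves_sq_sq eta nu Phi -> preserves_sq_circ eta^* nu Phi.
Proof. by move=> H a b c; rewrite -!sq_sq_eq_sq_circ H. Qed.

(** * Peirce corners *)

Section Peirce.
Variables (C : numClosedFieldType) (A : starAlgType C) (P : bool -> A).
Hypothesis PP : forall i j, P i * P j = if i == j then P i else 0.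
Hypothesis sumP : P true + P false = 1.
Implicit Types (i j l : bool) (a b d : A) (al : bool -> C).

Definition in_corner i j a := P i * a * P j = a.

Definition diag al : A := al true *: P true + al false *: P false.

Lemma mul_diag_P al i : diag al * P i = al i *: P i.
Proof.
by rewrite /diag mulrDl -!scalerAl !PP; case: i; rewrite /= scaler0 ?addr0 ?add0r.
Qed.

Lemma mul_P_diag al i : P i * diag al = al i *: P i.
Proof.
by rewrite /diag mulrDr -!scalerAr !PP; case: i; rewrite /= scaler0 ?addr0 ?add0r.
Qed.

Lemma in_cornerP i j a : in_corner i j (P i * a * P j).
Proof. by rewrite /in_corner !mulrA PP eqxx -!mulrA PP eqxx. Qed.

Lemma in_cornerZ i j k a : in_corner i j a -> in_corner i j (k *: a).
Proof. by rewrite /in_corner -scalerAr -scalerAl => ->. Qed.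

Lemma in_corner_mull i j k a :
  in_corner i j a -> P k * a = if k == i then a else 0.
Proof.
by move=> <-; rewrite !mulrA PP; case: eqP => [->|_]; rewrite ?mul0r.
Qed.

Lemma in_corner_mulr i j k a :
  in_corner i j a -> a * P k = if k == j then a else 0.
Proof.
by move=> <-; rewrite -!mulrA PP eq_sym; case: eqP => _; rewrite ?mulr0.
Qed.

Lemma in_corner_mul0 i j k l a b :
  in_corner i j a -> in_corner k l b -> j != k -> a * b = 0.
Proof.
move=> <- <- /negbTE jk.
by rewrite -!mulrA [P j * _]mulrA PP jk mul0r !mulr0.
Qed.

Lemma peirce_decomposition a :
  a = P true * a * P true + P true * a * P false
      + P false * a * P true + P false * a * P false.
Proof.
by rewrite -mulrDr -addrA -mulrDr sumP !mulr1 -mulrDl sumP mul1r.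
Qed.

Lemma peirce_eq0 a : (forall i j, P i * a * P j = 0) -> a = 0.
Proof. by move=> a0; rewrite (peirce_decomposition a) !a0 !addr0. Qed.

Lemma circ_diag_corner k al i j a :
  in_corner i j a -> circprod k (diag al) a = (al i + k * al j) *: a.
Proof.
move=> <-; rewrite /circprod !mulrA mul_diag_P -!mulrA mul_P_diag.
by rewrite -scalerAl -!scalerAr !scalerA -scalerDl.
Qed.

Lemma corner_circ_diag k al i j a :
  P i * circprod k (diag al) a * P j = (al i + k * al j) *: (P i * a * P j).
Proof.
rewrite /circprod mulrDr mulrDl -scalerAr -scalerAl !mulrA mul_P_diag.
rewrite -[P i * a * diag al * P j]mulrA mul_diag_P.
by rewrite -!scalerAl -scalerAr scalerA -scalerDl.
Qed.

Lemma corner_eq0_of_circ k al i j a :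
  circprod k (diag al) a = 0 -> al i + k * al j != 0 -> P i * a * P j = 0.
Proof.
move=> a0 nz; have := corner_circ_diag k al i j a.
rewrite a0 mulr0 mul0r => /esym /eqP.
by rewrite scaler_eq0 (negbTE nz) => /eqP.
Qed.

(** With [single i] the operator kills the diagonal corner opposite to i, and
    no other corner when kap is not 0 or -1. *)
Definition single i : bool -> C := fun l => (l == i)%:R.

(** With [balance k i] it kills the off-diagonal corner (i, ~~ i), since
    -k + k * 1 = 0, and no other corner when k is not 0, 1 or -1. *)
Definition balance (k : C) i : bool -> C := fun l => if l == i then - k else 1.

Lemma single_neq0 (kap : C) i k l : kap != 0 -> kap != -1 ->
  (k == i) || (l == i) -> single i k + kap * single i l != 0.
Proof.
move=> k0; rewrite -addr_eq0 addrC => k1; rewrite /single.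
by case: (k == i); case: (l == i); rewrite //= ?mulr1 ?mulr0 ?addr0 ?add0r ?oner_eq0.
Qed.

Lemma balance_neq0 (kap : C) i k l : kap != 0 -> kap != 1 -> kap != -1 ->
  (k != i) || (l == i) -> balance kap i k + kap * balance kap i l != 0.
Proof.
move=> k0; rewrite -subr_eq0 => k1; rewrite -addr_eq0 => k2; rewrite /balance.
have fE : 1 - kap * kap = (1 - kap) * (1 + kap).
  by rewrite mulrBl mul1r mulrDr mulr1 opprD addrA addrK.
case: (k == i); case: (l == i); rewrite //= ?mulr1 ?mulrN.
- by rewrite -opprD oppr_eq0 -[X in X + _]mulr1 -mulrDr mulf_neq0 // addrC.
- by rewrite fE => _; apply: mulf_neq0; [rewrite -oppr_eq0 opprB | rewrite addrC].
- by rewrite addrC.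
Qed.

Lemma circ_single_kill kap i a :
  in_corner (~~ i) (~~ i) a -> circprod kap (diag (single i)) a = 0.
Proof.
by move=> /(circ_diag_corner kap (single i)) ->; rewrite /single; case: i;
  rewrite mulr0 addr0 scale0r.
Qed.

Lemma circ_balance_kill kap i a :
  in_corner i (~~ i) a -> circprod kap (diag (balance kap i)) a = 0.
Proof.
by move=> /(circ_diag_corner kap (balance kap i)) ->; rewrite /balance; case: i;
  rewrite /= mulr1 addNr scale0r.
Qed.

End Peirce.

(** * Additivity *)

(** Only the additivity of the operator induced on B matters for the defect
    argument, so its formula, which differs for κ = ν and κ = ζ, is hidden. *)
Definition transported (C : numClosedFieldType) (A B : starAlgType C)
    (Phi : A -> B) (kap : C) :=
  forall d : A, exists2 g : B -> B, {morph g : x y / x + y} &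
    forall c, Phi (circprod kap d c) = g (Phi c).

Section Transport.
Variables (C : numClosedFieldType) (A B : starAlgType C) (zeta nu : C).
Variable Phi : A -> B.
Hypothesis Phi_bij : bijective Phi.
Hypothesis Phi_T : preserves_sq_circ zeta nu Phi.
Hypotheses (zetaN1 : zeta != -1) (nuN1 : nu != -1).

Let zeta1 : 1 + zeta != 0. Proof. by rewrite addrC addr_eq0. Qed.
Let nu1 : 1 + nu != 0. Proof. by rewrite addrC addr_eq0. Qed.

Lemma phi0 : Phi 0 = 0.
Proof.
have [Psi _ PsiK] := Phi_bij.
by have := Phi_T 0 0 (Psi 0); rewrite /sqprod !mulr0 mul0r scaler0 addr0
  {1}/circprod !(mul0r, mulr0) scaler0 addr0 PsiK circprod0r.
Qed.

Lemma phi_circ d c :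
  Phi (circprod nu d c)
  = circprod nu (sqprod zeta (Phi 1) (Phi ((1 + zeta)^-1 *: d))) (Phi c).
Proof. by rewrite -Phi_T sqprod1l scalerA divff // scale1r. Qed.

Lemma transported_nu : transported Phi nu.
Proof.
by move=> d; eexists; last exact: phi_circ; move=> x y; apply: circprodDr.
Qed.

Lemma transported_zeta : transported Phi zeta.
Proof.
move=> d; exists (fun y => circprod nu (sqprod zeta (Phi (star d)) y)
                                  (Phi ((1 + nu)^-1 *: 1))).
  by move=> x y; rewrite sqprodDr circprodDl.
move=> c; rewrite -Phi_T circprodZr circprodr1 scalerA mulVf // scale1r.
by rewrite sqprod_starl.
Qed.

End Transport.

Section Additivity.
Variables (C : numClosedFieldType) (A B : starAlgType C) (zeta nu kap : C).
Variable Phi : A -> B.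
Hypothesis Phi_bij : bijective Phi.
Hypothesis Phi_T : preserves_sq_circ zeta nu Phi.
Hypothesis zetaN1 : zeta != -1.
Hypothesis Phi_kap : transported Phi kap.
Hypotheses (kap0 : kap != 0) (kap1 : kap != 1) (kapN1 : kap != -1).
Variable P : bool -> A.
Hypothesis PP : forall i j, P i * P j = if i == j then P i else 0.
Hypothesis sumP : P true + P false = 1.
Hypothesis P_neq0 : forall i, P i <> 0.
Hypothesis A_prime : prime_algebra A.
Implicit Types (i j k l : bool) (a b d : A).

Let Phi0 : Phi 0 = 0 := phi0 Phi_bij Phi_T.

Definition additive_pair a b := Phi (a + b) = Phi a + Phi b.

Lemma additive_pair0l b : additive_pair 0 b.
Proof. by rewrite /additive_pair Phi0 !add0r. Qed.

Lemma additive_pair0r a : additive_pair a 0.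
Proof. by rewrite /additive_pair Phi0 !addr0. Qed.

(** With Phi t = Phi a + Phi b, the defect t - (a + b) is killed by every
    operator that maps (a, b) to a pair on which Phi is additive. *)
Lemma additive_pair_by_defect a b :
  (forall dlt,
     (forall d, additive_pair (circprod kap d a) (circprod kap d b) ->
        circprod kap d dlt = 0) -> dlt = 0) ->
  additive_pair a b.
Proof.
move=> detect; have [Psi PhiK PsiK] := Phi_bij.
have t_def := PsiK (Phi a + Phi b); set t := Psi _ in t_def.
rewrite /additive_pair -t_def; congr Phi; apply/esym/eqP; rewrite -subr_eq0.
apply/eqP/detect => d ab; rewrite circprodDr circprodNr circprodDr.
apply/eqP; rewrite subr_eq0; apply/eqP/(can_inj PhiK).
by have [g gD gE] := Phi_kap d; rewrite gE t_def gD -!gE.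
Qed.

Lemma additive_pair_offdiag i a b :
  in_corner P i (~~ i) a -> in_corner P (~~ i) i b -> additive_pair a b.
Proof.
move=> ca cb; apply: additive_pair_by_defect => dlt H.
have Hi : circprod kap (diag P (balance kap i)) dlt = 0.
  by apply: H; rewrite (circ_balance_kill PP _ ca); apply: additive_pair0l.
have Hj : circprod kap (diag P (balance kap (~~ i))) dlt = 0.
  apply: H; rewrite (circ_balance_kill PP _ (i := ~~ i) (a := b)) ?negbK //.
  exact: additive_pair0r.
apply: (peirce_eq0 sumP) => k l; case: (boolP ((k != i) || (l == i))) => kl.
  exact: (corner_eq0_of_circ PP Hi (balance_neq0 _ _ _ kl)).
apply: (corner_eq0_of_circ PP Hj (balance_neq0 _ _ _ _)) => //.
by case: (i) (k) (l) kl => -[] [].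
Qed.

(** The operator of [single (~~ i)] is injective on every corner except (i, i),
    where it vanishes.  When it annihilates the defect, only that corner is
    left to examine. *)
Lemma defect_in_corner i dlt :
  circprod kap (diag P (single C (~~ i))) dlt = 0 -> P i * dlt * P i = 0 ->
  dlt = 0.
Proof.
move=> Hj Hii; apply: (peirce_eq0 sumP) => k l.
have [kl|] := boolP ((k == ~~ i) || (l == ~~ i)).
  exact: (corner_eq0_of_circ PP Hj (single_neq0 _ _ kl)).
by case: (i) (k) (l) Hii => -[] [].
Qed.

Lemma additive_pair_diag_col i a b :
  in_corner P i i a -> in_corner P (~~ i) i b -> additive_pair a b.
Proof.
move=> ca cb; apply: additive_pair_by_defect => dlt H.
apply: (@defect_in_corner i).
  apply: H; rewrite (circ_single_kill PP _ (i := ~~ i) (a := a)) ?negbK //.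
  exact: additive_pair0l.
have Hj : circprod kap (diag P (balance kap (~~ i))) dlt = 0.
  apply: H; rewrite (circ_balance_kill PP _ (i := ~~ i) (a := b)) ?negbK //.
  exact: additive_pair0r.
by apply: (corner_eq0_of_circ PP Hj (balance_neq0 _ _ _ _)) => //; case: (i).
Qed.

Lemma additive_pair_diag_off i a b b' :
  in_corner P i i a -> in_corner P i (~~ i) b -> in_corner P (~~ i) i b' ->
  additive_pair a (b + b').
Proof.
move=> ca cb cb'; apply: additive_pair_by_defect => dlt H.
apply: (@defect_in_corner i).
  apply: H; rewrite (circ_single_kill PP _ (i := ~~ i) (a := a)) ?negbK //.
  exact: additive_pair0l.
have Hi : circprod kap (diag P (balance kap i)) dlt = 0.
  apply: H; rewrite circprodDr (circ_balance_kill PP _ cb) add0r.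
  rewrite (circ_diag_corner PP _ _ ca) (circ_diag_corner PP _ _ cb').
  by apply: (@additive_pair_diag_col i); apply: in_cornerZ.
by apply: (corner_eq0_of_circ PP Hi (balance_neq0 _ _ _ _)); rewrite ?eqxx ?orbT.
Qed.

Lemma additive_pair_diag_rest i a b c c' :
  in_corner P i i a -> in_corner P (~~ i) (~~ i) b ->
  in_corner P i (~~ i) c -> in_corner P (~~ i) i c' ->
  additive_pair a (b + (c + c')).
Proof.
move=> ca cb cc cc'; apply: additive_pair_by_defect => dlt H.
apply: (@defect_in_corner i).
  apply: H; rewrite (circ_single_kill PP _ (i := ~~ i) (a := a)) ?negbK //.
  exact: additive_pair0l.
have Hi : circprod kap (diag P (single C i)) dlt = 0.
  apply: H; rewrite 2!circprodDr (circ_single_kill PP _ cb) add0r.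
  rewrite (circ_diag_corner PP _ _ ca) (circ_diag_corner PP _ _ cc).
  rewrite (circ_diag_corner PP _ _ cc').
  by apply: (@additive_pair_diag_off i); apply: in_cornerZ.
by apply: (corner_eq0_of_circ PP Hi (single_neq0 _ _ _)); rewrite ?eqxx ?orbT.
Qed.

Lemma phi_corners i a b c c' :
  in_corner P i i a -> in_corner P (~~ i) (~~ i) b ->
  in_corner P i (~~ i) c -> in_corner P (~~ i) i c' ->
  Phi (a + (b + (c + c'))) = Phi a + (Phi b + (Phi c + Phi c')).
Proof.
move=> ca cb cc cc'; rewrite (additive_pair_diag_rest ca cb cc cc').
rewrite [c + c']addrC (@additive_pair_diag_off (~~ i)) ?negbK //.
by rewrite (@additive_pair_offdiag (~~ i)) ?negbK // [Phi c' + _]addrC.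
Qed.

Lemma phi_peirce a :
  Phi a = Phi (P true * a * P true) + (Phi (P false * a * P false)
          + (Phi (P true * a * P false) + Phi (P false * a * P true))).
Proof.
rewrite -(@phi_corners true) ?in_cornerP; try exact: in_cornerP.
congr Phi; rewrite {1}(peirce_decomposition sumP a) -!addrA; congr (_ + _).
by rewrite addrA addrC.
Qed.

(** Here a + b = (P_i + a) ∘_ν (P_j + b) with j = ~~ i, because every other
    term of the expansion multiplies mismatched corners; both factors are sums
    across corners, where additivity is known. *)
Lemma additive_in_offdiag i a b :
  in_corner P i (~~ i) a -> in_corner P i (~~ i) b -> additive_pair a b.
Proof.
move=> ca cb; set j := ~~ i; set z := (1 + zeta)^-1.
have ji : (j == i) = false by rewrite /j; case: (i).
have ij : (i == j) = false by rewrite /j; case: (i).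
have PE : circprod nu (P i) (P j) = 0.
  by rewrite /circprod !PP ij ji scaler0 addr0.
have PbE : circprod nu (P i) b = b.
  rewrite /circprod (in_corner_mull PP i cb) (in_corner_mulr PP i cb) eqxx.
  by rewrite ij scaler0 addr0.
have aPE : circprod nu a (P j) = a.
  rewrite /circprod (in_corner_mulr PP j ca) (in_corner_mull PP j ca) eqxx.
  by rewrite ji scaler0 addr0.
have abE : circprod nu a b = 0.
  rewrite /circprod (in_corner_mul0 PP ca cb) ?(in_corner_mul0 PP cb ca) //.
  - by rewrite scaler0 addr0.
  - by rewrite -/j ji.
  - by rewrite -/j ji.
have cP k : in_corner P k k (P k) by rewrite /in_corner !PP eqxx PP eqxx.
have DPa : Phi (z *: (P i + a)) = Phi (z *: P i) + Phi (z *: a).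
  have c0 : in_corner P j i 0 by rewrite /in_corner mulr0 mul0r.
  rewrite scalerDr -[z *: a]addr0.
  by apply: (@additive_pair_diag_off i); rewrite ?addr0 //; apply: in_cornerZ.
have DPb : Phi (P j + b) = Phi (P j) + Phi b.
  by apply: (@additive_pair_diag_col j); rewrite /j ?negbK //; apply: cP.
rewrite /additive_pair.
have -> : a + b = circprod nu (P i + a) (P j + b).
  by rewrite circprodDr !circprodDl PE PbE aPE abE add0r addr0.
rewrite (phi_circ Phi_T zetaN1) DPa DPb sqprodDr circprodDr 2!circprodDl.
by rewrite /z -!(phi_circ Phi_T zetaN1) PE PbE aPE abE Phi0 add0r addr0.
Qed.

(** The defect lies in the corner (i, i) and is killed by right multiplication
    by all P_i x P_j with j = ~~ i, which is impossible in a prime algebra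
    unless it vanishes. *)
Lemma additive_in_diag i a b :
  in_corner P i i a -> in_corner P i i b -> additive_pair a b.
Proof.
move=> ca cb; apply: additive_pair_by_defect => dlt H.
have Hj : circprod kap (diag P (single C (~~ i))) dlt = 0.
  apply: H; rewrite (circ_single_kill PP _ (i := ~~ i) (a := a)) ?negbK //.
  exact: additive_pair0l.
apply: (@defect_in_corner i) => //; set e := P i * dlt * P i.
suff e0 x : e * x * P (~~ i) = 0.
  by case: (A_prime e0) => // /P_neq0.
set w := P i * x * P (~~ i).
have cw : in_corner P i (~~ i) w by apply: in_cornerP.
have wE y : in_corner P i i y -> circprod kap w y = kap *: (y * w).
  move=> cy; rewrite /circprod (in_corner_mul0 PP cw cy) ?add0r //.
  by case: (i).
have cyw y : in_corner P i i y -> in_corner P i (~~ i) (kap *: (y * w)).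
  move=> cy; apply: in_cornerZ; rewrite /in_corner mulrA.
  rewrite (in_corner_mull PP _ cy) eqxx -mulrA.
  by rewrite (in_corner_mulr PP _ cw) eqxx.
have := H w; rewrite (wE a ca) (wE b cb) => /(_ (additive_in_offdiag (cyw _ ca) (cyw _ cb))).
(* Only the corner (i, ~~ i) of the resulting equation is of interest. *)
move=> /(congr1 (fun y => P i * y * P (~~ i))); rewrite mulr0 mul0r.
rewrite /circprod mulrDr mulrDl [P i * (w * dlt)]mulrA.
rewrite (in_corner_mull PP i cw) eqxx.
have -> : w * dlt * P (~~ i) = 0.
  rewrite /w -!mulrA [P (~~ i) * _]mulrA.
  by rewrite (corner_eq0_of_circ PP Hj (single_neq0 _ _ _)) ?eqxx // !mulr0.
rewrite add0r -scalerAr -scalerAl => /eqP.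
rewrite scaler_eq0 (negbTE kap0) => /eqP; rewrite /w /e.
by rewrite -!mulrA PP eqxx !mulrA.
Qed.

Lemma phiD : {morph Phi : a b / a + b}.
Proof.
move=> a b; rewrite (phi_peirce (a + b)) (phi_peirce a) (phi_peirce b).
rewrite !mulrDr !mulrDl.
have c := in_cornerP PP.
rewrite (additive_in_diag (c _ _ a) (c _ _ b)).
rewrite (additive_in_diag (c _ _ a) (c _ _ b)).
rewrite (additive_in_offdiag (c true _ a) (c _ _ b)).
rewrite (additive_in_offdiag (c false _ a) (c _ _ b)).
rewrite [in RHS]addrACA; congr (_ + _).
by rewrite [in RHS]addrACA; congr (_ + _); rewrite addrACA.
Qed.

End Additivity.

Lemma additive_of_preserves_sq_circ (C : numClosedFieldType)
    (A B : starAlgType C) (zeta nu : C) (Phi : A -> B) :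
  prime_algebra A -> (exists p : A, nontrivial_projection p) ->
  bijective Phi -> preserves_sq_circ zeta nu Phi ->
  zeta != -1 -> nu != -1 ->
  nu != 0 /\ nu != 1 \/ zeta != 0 /\ zeta != 1 ->
  {morph Phi : a b / a + b}.
Proof.
move=> prA [p [[_ pp] p0 p1]] bij HT z1 n1 knz.
pose P i := if i then p else 1 - p.
have PP i j : P i * P j = if i == j then P i else 0.
  by case: i; case: j; rewrite /P /= ?mulrBl ?mulrBr ?mulr1 ?mul1r -?pp ?subrr ?subr0.
have sumP : P true + P false = 1 by rewrite /P addrC subrK.
have P0 i : P i <> 0.
  by case: i => //= /eqP; rewrite subr_eq0 eq_sym => /eqP.
case: knz => [[k0 k1] | [k0 k1]].
  have tr := transported_nu HT z1.
  exact: (phiD bij HT z1 tr k0 k1 n1 PP sumP P0 prA).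
have tr := transported_zeta HT n1.
exact: (phiD bij HT z1 tr k0 k1 z1 PP sumP P0 prA).
Qed.

(** * Multiplicativity *)

Section Multiplicativity.
Variables (C : numClosedFieldType) (A B : starAlgType C) (zeta nu : C).
Variable Phi : A -> B.
Hypothesis Phi_bij : bijective Phi.
Hypothesis Phi_T : preserves_sq_circ zeta nu Phi.
Hypotheses (zetaN1 : zeta != -1) (nuN1 : nu != -1).
Hypothesis Phi1_proj : projection (Phi 1).
Hypothesis PhiD : {morph Phi : a b / a + b}.

Let zeta1 : 1 + zeta != 0. Proof. by rewrite addrC addr_eq0. Qed.
Let nu1 : 1 + nu != 0. Proof. by rewrite addrC addr_eq0. Qed.
Let PhiB : {morph Phi : a b / a - b}.
Proof. by move=> a b; apply/eqP; rewrite eq_sym subr_eq -PhiD subrK. Qed.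

(** Put q = Phi 1.  As T(1, 1, c) = (1 + ζ)(1 + ν) c is arbitrary, so is its
    image (1 + ζ)(q y + ν y q), where y = Phi c.  For some y this image is
    1 - q, yet (1 - q) (q y + ν y q) (1 - q) = 0. *)
Lemma phi1 : Phi 1 = 1.
Proof.
have [Psi _ PsiK] := Phi_bij; have [qs qq] := Phi1_proj; set q := Phi 1 in qs qq *.
have ortho_l : (1 - q) * q = 0 by rewrite mulrBl mul1r -qq subrr.
have ortho_r : q * (1 - q) = 0 by rewrite mulrBr mulr1 -qq subrr.
pose c := (1 + nu)^-1 *: ((1 + zeta)^-1 *: Psi (1 - q)).
have qE : 1 - q = (1 + zeta) *: circprod nu q (Phi c).
  have sq_q : sqprod zeta q q = (1 + zeta) *: q.
    by rewrite /sqprod -qs -qq scalerDl scale1r.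
  have := Phi_T 1 1 c; rewrite -/q sqprod1l sq_q !circprodZl circprod1l.
  rewrite {1}/c (scalerA (1 + nu)) divff // scale1r (scalerA (1 + zeta)).
  by rewrite divff // scale1r PsiK.
have corner0 y : (1 - q) * circprod nu q y * (1 - q) = 0.
  rewrite /circprod (mulrDr (1 - q)) mulrDl mulrA ortho_l !mul0r add0r.
  by rewrite -scalerAr -scalerAl -!mulrA ortho_r !mulr0 scaler0.
have : (1 - q) * (1 - q) * (1 - q) = 0.
  by rewrite {2}qE -scalerAr -scalerAl corner0 scaler0.
rewrite mulrBl mul1r ortho_r subr0 mulrBl mul1r ortho_r subr0.
by move/eqP; rewrite subr_eq0 => /eqP.
Qed.

Lemma phi_circ_units y c :
  Phi ((1 + zeta) *: circprod nu y c)
  = (1 + zeta) *: circprod nu (Phi y) (Phi c).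
Proof. by have := Phi_T 1 y c; rewrite phi1 !sqprod1l !circprodZl. Qed.

Lemma phi_mu c :
  Phi (((1 + zeta) * (1 + nu)) *: c) = ((1 + zeta) * (1 + nu)) *: Phi c.
Proof. by have := phi_circ_units c 1; rewrite phi1 !circprodr1 !scalerA. Qed.

Lemma phi_sq_units x y :
  Phi ((1 + nu) *: sqprod zeta x y) = (1 + nu) *: sqprod zeta (Phi x) (Phi y).
Proof. by have := Phi_T x y 1; rewrite phi1 !circprodr1. Qed.

Lemma phi_star : {morph Phi : a / star a}.
Proof.
move=> a; apply: (scalerI (mulf_neq0 zeta1 nu1)); rewrite -phi_mu.
have := phi_sq_units a 1.
by rewrite phi1 !sqprodr1 !scalerA (mulrC (1 + nu)).
Qed.

Lemma phi_jordan x y :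
  Phi (x * y + y * x) = Phi x * Phi y + Phi y * Phi x.
Proof.
apply: (scalerI (mulf_neq0 zeta1 nu1)); rewrite -phi_mu -!scalerA.
by rewrite -!circprod_add_swap [in LHS]scalerDr [in RHS]scalerDr PhiD
  !phi_circ_units.
Qed.

Lemma phi_mul_of_commutators :
  (forall x y, Phi (x * y - y * x) = Phi x * Phi y - Phi y * Phi x) ->
  {morph Phi : x y / x * y}.
Proof.
move=> comm x y; apply: (scalerI (_ : 2%:R != 0 :> C)); first by rewrite pnatr_eq0.
have dbl (D : starAlgType C) (u v : D) : 2%:R *: u = (u + v) + (u - v).
  by rewrite addrACA subrr addr0 scaler_nat mulr2n.
rewrite (dbl _ (Phi x * Phi y) (Phi y * Phi x)) -phi_jordan -comm -PhiD.
by rewrite -dbl !scaler_nat !mulr2n PhiD.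
Qed.

Lemma phi_mul_nu : nu != 1 ->
  commutes_with_scalar ((zeta + 1) * (1 - nu)) Phi -> {morph Phi : x y / x * y}.
Proof.
move=> n1 lam; apply: phi_mul_of_commutators => x y.
have nz : (zeta + 1) * (1 - nu) != 0.
  by apply: mulf_neq0; [rewrite addr_eq0 | rewrite subr_eq0 eq_sym].
apply: (scalerI nz); rewrite -lam -!scalerA -!circprod_sub_swap.
by rewrite (addrC zeta) [in LHS]scalerBr [in RHS]scalerBr PhiB !phi_circ_units.
Qed.

Lemma phi_mul_zeta : zeta != 1 ->
  commutes_with_scalar ((zeta - 1) * (1 + nu)) Phi -> {morph Phi : x y / x * y}.
Proof.
move=> z1 lam; apply: phi_mul_of_commutators => x y.
have nz : (zeta - 1) * (1 + nu) != 0 by rewrite mulf_neq0 // subr_eq0.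
have circ_units u v : Phi ((1 + nu) *: circprod zeta u v)
    = (1 + nu) *: circprod zeta (Phi u) (Phi v).
  by rewrite -!sqprod_starl -phi_star phi_sq_units.
apply: (scalerI nz); rewrite -lam (mulrC (zeta - 1)) -!scalerA.
rewrite -opprB !scaleNr -!circprod_sub_swap !opprB.
by rewrite [in LHS]scalerBr [in RHS]scalerBr PhiB !circ_units.
Qed.

End Multiplicativity.

Lemma star_ring_isomorphism_of_preserves (C : numClosedFieldType)
    (A B : starAlgType C) (zeta nu : C) (Phi : A -> B) :
  bijective Phi -> preserves_sq_circ zeta nu Phi ->
  zeta != -1 -> nu != -1 -> projection (Phi 1) ->
  {morph Phi : a b / a + b} ->
  nu != 1 /\ commutes_with_scalar ((zeta + 1) * (1 - nu)) Phi \/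
  zeta != 1 /\ commutes_with_scalar ((zeta - 1) * (1 + nu)) Phi ->
  star_ring_isomorphism Phi.
Proof.
move=> bij HT z1 n1 pr PhiD H; split => //; first exact: phi_star HT _ _ pr.
case: H => -[k1 lam].
  exact: (phi_mul_nu bij HT z1 n1 pr PhiD k1 lam).
exact: (phi_mul_zeta bij HT z1 n1 pr PhiD k1 lam).
Qed.

Lemma commutes_with_rational (C : numClosedFieldType) (A B : starAlgType C)
    (Phi : A -> B) (z : C) :
  {morph Phi : a b / a + b} -> rational_number z -> commutes_with_scalar z Phi.
Proof.
move=> PhiD [q ->] a.
have Phi0 : Phi 0 = 0 by apply: (addrI (Phi 0)); rewrite -PhiD !addr0.
have PhiN b : Phi (- b) = - Phi b.
  by apply/eqP; rewrite -addr_eq0 -PhiD addNr Phi0.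
have PhiMn b n : Phi (b *+ n) = Phi b *+ n.
  by elim: n => [|n IHn]; rewrite ?mulr0n // !mulrS PhiD IHn.
have PhiZ b (m : int) : Phi (m%:~R *: b) = m%:~R *: Phi b.
  by case: m => n; rewrite ?NegzE ?mulrNz ?scaleNr ?PhiN -!pmulrn !scaler_nat PhiMn.
have dnz : (denq q)%:~R != 0 :> C by rewrite intr_eq0 denq_eq0.
apply: (scalerI dnz); rewrite -PhiZ !scalerA.
by rewrite /ratr mulrC divfK // PhiZ.
Qed.

(** With zeta the conjugate of eta, (A) reduces to this; (B) is the case
    zeta = eta, its conditions on moduli giving those required here. *)
Lemma preserves_sq_circ_star_ring_isomorphism (C : numClosedFieldType)
    (A B : starAlgType C) (zeta nu : C) (Phi : A -> B) :
  prime_algebra A -> (exists p : A, nontrivial_projection p) ->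
  zeta != 0 -> nu != 0 -> bijective Phi -> projection (Phi 1) ->
  preserves_sq_circ zeta nu Phi -> zeta != -1 -> nu != -1 ->
  nu != 1 /\ (commutes_with_scalar ((zeta + 1) * (1 - nu)) Phi \/
              rational_number ((zeta + 1) * (1 - nu))) \/
  zeta != 1 /\ (commutes_with_scalar ((zeta - 1) * (1 + nu)) Phi \/
                rational_number ((zeta - 1) * (1 + nu))) ->
  star_ring_isomorphism Phi.
Proof.
move=> prA projA z0 n0 bij pr HT z1 n1 H.
have PhiD : {morph Phi : a b / a + b}.
  apply: (additive_of_preserves_sq_circ prA projA bij HT z1 n1).
  by case: H => -[k1 _]; [left | right].
apply: (star_ring_isomorphism_of_preserves bij HT) => //.
case: H => -[k1 lam]; [left | right]; split=> //;
  by case: lam => // /(commutes_with_rational PhiD).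
Qed.

Theorem corollary2p2 (R : realType) (A B : starAlgType R[i])
    (eta nu : R[i]) (Phi : A -> B)
    (A_prime : prime_algebra A)
    (A_proj : exists p : A, nontrivial_projection p)
    (eta_neq0 : eta != 0) (nu_neq0 : nu != 0)
    (Phi_bij : bijective Phi)
    (Phi1_proj : projection (Phi 1)) :
  ((preserves_sq_sq eta nu Phi ->
     [/\ eta^* != -1, nu != 1, nu != -1 &
         commutes_with_scalar ((eta^* + 1) * (1 - nu)) Phi] \/
     [/\ eta^* != 1, eta^* != -1, nu != -1 &
         commutes_with_scalar ((eta^* - 1) * (1 + nu)) Phi] ->
     star_ring_isomorphism Phi) /\
   (preserves_sq_sq eta nu Phi ->
     [/\ eta^* != -1, nu != 1, nu != -1 &
         rational_number ((eta^* + 1) * (1 - nu))] \/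
     [/\ eta^* != 1, eta^* != -1, nu != -1 &
         rational_number ((eta^* - 1) * (1 + nu))] ->
     star_ring_isomorphism Phi)) /\
  ((preserves_sq_circ eta nu Phi ->
     [/\ eta != -1, `|nu| != 1 &
         commutes_with_scalar ((eta + 1) * (1 - nu)) Phi] \/
     [/\ `|eta| != 1, nu != -1 &
         commutes_with_scalar ((eta - 1) * (1 + nu)) Phi] ->
     star_ring_isomorphism Phi) /\
   (preserves_sq_circ eta nu Phi ->
     [/\ eta != -1, `|nu| != 1 &
         rational_number ((eta + 1) * (1 - nu))] \/
     [/\ `|eta| != 1, nu != -1 &
         rational_number ((eta - 1) * (1 + nu))] ->
     star_ring_isomorphism Phi)).
Proof.
have main zeta := @preserves_sq_circ_star_ring_isomorphism _ A B zeta nu Phi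
  A_prime A_proj.
have eta_conj0 : eta^* != 0 by rewrite conjC_eq0.
have norm_neq (z : R[i]) : `|z| != 1 -> z != 1 /\ z != -1.
  by move=> z1; split; apply: contraNneq z1 => ->; rewrite ?normrN normr1.
split; split=> HT.
- have HT' := preserves_sq_sq_circ HT.
  by case=> -[? ? ? ?]; apply: main HT' _ _ _ => //; [left | right]; split=> //; left.
- have HT' := preserves_sq_sq_circ HT.
  by case=> -[? ? ? ?]; apply: main HT' _ _ _ => //; [left | right]; split=> //; right.
- case=> -[h1 h2 h3].
    by have [? ?] := norm_neq _ h2; apply: main HT _ _ _ => //; left; split=> //; left.
  by have [? ?] := norm_neq _ h1; apply: main HT _ _ _ => //; right; split=> //; left.
- case=> -[h1 h2 h3].
    by have [? ?] := norm_neq _ h2; apply: main HT _ _ _ => //; left; split=> //; right.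
  by have [? ?] := norm_neq _ h1; apply: main HT _ _ _ => //; right; split=> //; right.
Qed.
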